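(* Let $k$ be an algebraically closed field and let $\mathcal{J}$ be a homogeneous ideal of $k[x_0,\dots,x_m]$ such that the corresponding projective variety $V(\mathcal{J})$ is a finite subset of $\mathbb{P}^m(k)$. Then for all $e\gg 0$, $$|V(\mathcal{J})|\le |\Delta_e(\mathcal{J})|,$$ with equality (for all $e\gg 0$) if $\mathcal{J}$ is a radical ideal.
   Context: $m$ is a positive integer. $V(\mathcal{J})$ is the set of all $P\in\mathbb{P}^m(k)$ such that $F(P)=0$ for all homogeneous $F\in\mathcal{J}$. A monomial order $\preccurlyeq$ on the set of all monomials in $x_0,\dots,x_m$ is fixed, with $x_0\succ x_1\succ\cdots\succ x_m$; $\mathrm{lm}(F)$ denotes the leading monomial of a nonzero polynomial $F$ with respect to it. $\mathbb{M}_e$ is the set of monomials in $x_0,\dots,x_m$ of degree $e$. For $e\in\mathbb{N}=\{0,1,2,\dots\}$, the projective footprint of $\mathcal{J}$ in degree $e$ is $$\Delta_e(\mathcal{J}):=\{\mu\in\mathbb{M}_e : \mu\ne \mathrm{lm}(F)\text{ for all homogeneous }F\in\mathcal{J}\text{ with }F\ne 0\}.$$ ''For all $e\gg 0$'' means: there is $e_0\in\mathbb{N}$ such that the assertion holds for all integers $e\ge e_0$. *)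

(* Defs.v *)
From mathcomp Require Import all_boot all_order all_algebra.
From mathcomp Require Import mpoly.
From mathcomp Require Import boolp classical_sets functions cardinality.

Set Implicit Arguments.
Unset Strict Implicit.
Unset Printing Implicit Defensive.

Import GRing.Theory.
Local Open Scope ring_scope.
Local Open Scope classical_set_scope.

(* Monomials are written additively: [0%MM] is the monomial 1 and [m1 + m2] is
   the product of [m1] and [m2]. *)
Record monomial_order (n : nat) (le : rel 'X_{1..n}) : Prop := MonomialOrder {
  mo_anti : antisymmetric le;
  mo_trans : transitive le;
  mo_total : total le;
  mo_le0m : forall mu, le 0%MM mu;
  mo_add2r : forall nu mu mu', le mu mu' -> le (mu + nu)%MM (mu' + nu)%MM
}.

(* The library's [mlead] is tied to the degrevlex order; this is its analogue
   for an arbitrary order. As there, the value at 0 is [0%MM]. *)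
Definition lm (n : nat) (R : nzRingType) (le : rel 'X_{1..n})
    (F : {mpoly R[n]}) : 'X_{1..n} :=
  \big[(fun mu nu => if le mu nu then nu else mu) / 0%MM]_(mu <- msupp F) mu.

Lemma lm_supp_max (n : nat) (R : nzRingType) (le : rel 'X_{1..n})
    (F : {mpoly R[n]}) : monomial_order le -> F != 0 ->
  lm le F \in msupp F /\ {in msupp F, forall mu, le mu (lm le F)}.
Proof.
case=> leas letr letot le0 _; rewrite -msupp_eq0 /lm.
have lexx x : le x x by have := letot x x; rewrite orbb.
elim: (msupp F) => [//|mu s IHs] _; rewrite big_cons.
have [-> | /IHs[]] := eqVneq s [::].
  rewrite big_nil; case: ifP => [mu0|_].
    have -> : mu = 0%MM by apply: leas; rewrite mu0 le0.
    by rewrite mem_head; split=> // x; rewrite inE => /eqP->.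
  by rewrite mem_head; split=> // x; rewrite inE => /eqP->.
set nu := \big[_/_]_(_ <- _) _ => nu_s le_nu; case: ifP => [le_mu_nu|/negP nle].
  rewrite inE nu_s orbT; split=> // x; rewrite inE => /predU1P[->//|].
  exact: le_nu.
have le_nu_mu : le nu mu by case/orP: (letot mu nu).
rewrite mem_head; split=> // x; rewrite inE => /predU1P[->//|/le_nu].
by move=> le_x; apply: letr le_nu_mu.
Qed.

Definition is_ideal (A : comNzRingType) (J : set A) : Prop :=
  [/\ J 0, (forall F G, J F -> J G -> J (F + G)) &
      forall H F, J F -> J (H * F)].

Definition radical (A : comNzRingType) (J : set A) : set A :=
  [set F | exists r : nat, J (F ^+ r)].

Definition is_homogeneous_ideal (n : nat) (R : comNzRingType)
    (J : set {mpoly R[n]}) : Prop :=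
  is_ideal J /\ forall F d, J F -> J (pihomog mdeg d F).

(* Points of P^m(k) are the lines through the origin of k^(m+1). *)
Definition proj_space (k : fieldType) (m : nat) : Type :=
  {P : {vspace 'rV[k]_m.+1} | \dim P == 1%N}.

(* F(P) = 0, i.e. F vanishes at all homogeneous coordinate vectors of P. *)
Definition vanishes_at (k : fieldType) (m : nat) (F : {mpoly k[m.+1]})
    (P : proj_space k m) : Prop :=
  forall v : 'rV[k]_m.+1, v \in val P -> v != 0 -> F.@[v 0] = 0.

Definition proj_variety (k : fieldType) (m : nat) (J : set {mpoly k[m.+1]}) :
    set (proj_space k m) :=
  [set P | forall F, J F -> F \is homog mdeg -> vanishes_at F P].

Definition proj_footprint (k : fieldType) (m : nat) (le : rel 'X_{1..m.+1})
    (J : set {mpoly k[m.+1]}) (e : nat) : set 'X_{1..m.+1} :=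
  [set mu | mdeg mu = e /\
    forall F, J F -> F \is homog mdeg -> F != 0 -> mu <> lm le F].

Lemma finite_proj_footprint (k : fieldType) (m : nat) (le : rel 'X_{1..m.+1})
    (J : set {mpoly k[m.+1]}) (e : nat) : finite_set (proj_footprint le J e).
Proof.
apply: (@sub_finite_set _ _ [set bmnm x | x in [set: 'X_{1..m.+1 < e.+1}]]).
  move=> mu [mue _]; have lt_mu : (mdeg mu < e.+1)%N by rewrite mue.
  by exists (BMultinom lt_mu).
exact/finite_image/finite_finset.
Qed.

(* Main.v *)
Require Import Defs.
From mathcomp Require Import all_boot all_order all_algebra.
From mathcomp Require Import mpoly ring.
From mathcomp Require Import boolp classical_sets functions cardinality.

(* Write S for the polynomial ring.  The monomials of the footprint in degree e
   form a basis of (S/J)_e, so the theorem compares dim (S/J)_e with |V(J)|.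
   For e >= |V(J)| some forms of degree e separate the points of V(J), whence
   |V(J)| <= dim (S/J)_e; equality amounts to: every form vanishing on V(J)
   lies in J.

   This Nullstellensatz comes from commuting matrices.  Let l be a linear form
   with S_s contained in J + (l), and let F be a form vanishing on V(J).
   Replacing J by J' = (J : (Fl)^oo) makes l injective on S/J', hence bijective
   from (S/J')_s to (S/J')_(s+1); a common eigenvector of the l^-1 x_i on
   (S/J')_s would give a point of V(J) at which F does not vanish.  So
   (S/J')_s = 0, and some F^a S_t lies in J for all t >> 0.  With F = 1, adding
   the variables to J one at a time, this shows that J contains some S_s when
   V(J) is empty.  When V(J) is finite, a linear form l without zero on V(J)
   makes V(J + (l)) empty, so that the hypothesis on l always holds. *)
Set Implicit Arguments.
Unset Strict Implicit.
Unset Printing Implicit Defensive.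

Import GRing.Theory.
Local Open Scope ring_scope.
Local Open Scope classical_set_scope.
Local Open Scope card_scope.

(** * Eigenvectors of commuting matrices in a stable subspace *)

Section CommonEigenvector.
Variables (k : closedFieldType) (n : nat).

(** The characteristic polynomial of the restriction of [A] to [V] has a root, [k] being
    algebraically closed; an eigenvector of the restriction, written in coordinates of [row_base V],
    is carried back to [V]. *)
Lemma stable_eigenvector (V A : 'M[k]_n) :
  V != 0 -> stablemx V A -> exists a, (V :&: eigenspace A a)%MS != 0.
Proof.
move=> V_neq0 stVA; have rV_gt0 : (0 < \rank V)%N by rewrite lt0n mxrank_eq0.
have [a] : exists a, root (char_poly (restrictmx V A)) a.
  by apply/closed_rootP; rewrite size_char_poly eqSS -lt0n.
rewrite -eigenvalue_root_char => /eigenvalueP [v vA v_neq0].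
exists a; apply: contraNneq v_neq0 => VI0.
rewrite -(mulmx_free_eq0 _ (row_base_free V)) -submx0 -VI0 sub_capmx.
rewrite (submx_trans (submxMl _ _)) ?eq_row_base //=; apply/eigenspaceP.
by rewrite scalemxAl -vA -[RHS]mulmxA mulmxKpV ?stablemx_row_base ?mulmxA.
Qed.

(** Induction on the list: the part of [V] in an eigenspace of the first matrix is nonzero, and it
    is stable under the other matrices because they commute with the first. *)
Lemma common_eigenvector (As : seq 'M[k]_n) (V : 'M[k]_n) :
  V != 0 -> {in As, forall A, stablemx V A} ->
  {in As &, forall A B, comm_mx A B} ->
  exists2 v : 'rV_n, v != 0 /\ (v <= V)%MS &
    {in As, forall A, exists a, v *m A = a *: v}.
Proof.
elim: As V => [|A As IHAs] V V_neq0 stV cAs.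
  by have /rowV0Pn [v vV v_neq0] := V_neq0; exists v.
have AAs : A \in A :: As by rewrite mem_head.
have sAs B : B \in As -> B \in A :: As by rewrite inE => ->; rewrite orbT.
have [a W_neq0] := stable_eigenvector V_neq0 (stV A AAs).
have [|B C BAs CAs|v [v_neq0]] := IHAs _ W_neq0.
- move=> B BAs /=; have stE : stablemx (eigenspace A a) B.
    by apply/comm_mx_stable_eigenspace/cAs/sAs.
  have := capmxMr V (eigenspace A a) B; move/submx_trans; apply.
  by rewrite capmxS // stV // sAs.
- by apply: cAs; apply: sAs.
rewrite sub_capmx => /andP[vV /eigenspaceP vA] vAs; exists v => // B.
by rewrite inE => /predU1P[->|/vAs//]; exists a.
Qed.

End CommonEigenvector.

(** * Homogeneous ideals, adjunction of a linear form, saturation *)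

Section HomogeneousIdeals.
Variables (n : nat) (k : fieldType).
Implicit Types (F G H l : {mpoly k[n]}) (J : set {mpoly k[n]}).

Lemma dhomog_ind (P : {mpoly k[n]} -> Prop) d :
  P 0 -> (forall F G, P F -> P G -> P (F + G)) ->
  (forall c F, P F -> P (c *: F)) ->
  (forall mu, mdeg mu = d -> P 'X_[mu]) ->
  forall G, G \is d.-homog -> P G.
Proof.
move=> P0 PD PZ PX G /dhomogP Gd; rewrite [G]mpolyE big_seq.
by apply: big_ind => // mu /Gd /PX; apply: PZ.
Qed.

Lemma mdegS_split (mu : 'X_{1..n}) d :
  mdeg mu = d.+1 -> exists i nu, mu = (U_(i) + nu)%MM /\ mdeg nu = d.
Proof.
move=> mu_d; have [i mu_i|mu0] := pickP (fun i => mu i != 0%N); last first.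
  suff : mdeg mu = 0%N by rewrite mu_d.
  by rewrite mdegE big1 // => i _; have /negbFE/eqP := mu0 i.
exists i, (mu - U_(i))%MM.
have mu_eq : mu = (U_(i) + (mu - U_(i)))%MM.
  rewrite addmC submK //; apply/mnm_lepP => j; rewrite mnm1E.
  by case: eqP => // <-; rewrite lt0n.
split=> //; move: mu_d; rewrite {1}mu_eq mdegD mdeg1.
by case.
Qed.

Lemma pihomogMl A G d e : A \is d.-homog ->
  pihomog mdeg (d + e) (A * G) = A * pihomog mdeg e G.
Proof.
move=> Aa; rewrite [G]mpolyE mulr_sumr !linear_sum /= mulr_sumr.
apply: eq_bigr => mu _; rewrite -scalerAr !linearZ /= -scalerAr; congr (_ *: _).
have AX : A * 'X_[mu] \is (d + mdeg mu).-homog by rewrite dhomogM // dhomogX.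
rewrite pihomogX; case: eqP => [<-|/eqP mu_e]; first by rewrite pihomog_dE.
by rewrite mulr0 (pihomog_ne0 _ AX) // eqn_add2l.
Qed.

Lemma pihomogMl_lt A G d e : A \is d.-homog -> (e < d)%N ->
  pihomog mdeg e (A * G) = 0.
Proof.
move=> Aa lt_ed; rewrite [G]mpolyE mulr_sumr linear_sum /=.
rewrite big1 // => mu _; rewrite -scalerAr linearZ /=.
have AX : A * 'X_[mu] \is (d + mdeg mu).-homog by rewrite dhomogM // dhomogX.
by rewrite (pihomog_ne0 _ AX) ?scaler0 // gtn_eqF // ltn_addr.
Qed.

Lemma idealMr J F H : is_ideal J -> J F -> J (F * H).
Proof. by case=> _ _ JM JF; rewrite mulrC; apply: JM. Qed.

Lemma idealZ J c F : is_ideal J -> J F -> J (c *: F).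
Proof. by case=> _ _ JM JF; rewrite -mul_mpolyC; apply: JM. Qed.

Lemma idealB J F G : is_ideal J -> J F -> J G -> J (F - G).
Proof.
move=> Jid JF JG; rewrite -scaleN1r; case: (Jid) => _ JD _.
by apply: JD => //; apply: idealZ.
Qed.

Lemma ideal_sum J (I : Type) (r : seq I) (P : pred I) (F_ : I -> {mpoly k[n]}) :
  is_ideal J -> (forall i, P i -> J (F_ i)) -> J (\sum_(i <- r | P i) F_ i).
Proof. by case=> J0 JD _ JF; apply: big_ind. Qed.

Definition contains_degree J s := forall G, G \is s.-homog -> J G.

(** The ideal J + (l). *)
Definition add_gen J l := [set F | exists H, J (F - H * l)].

(* The ideal (J : F^oo). *)
Definition saturation J F := [set G | exists r, J (F ^+ r * G)].

Lemma sub_add_gen J l F : J F -> add_gen J l F.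
Proof. by exists 0; rewrite mul0r subr0. Qed.

Lemma add_genM J l H : is_ideal J -> add_gen J l (H * l).
Proof. by case=> J0 _ _; exists H; rewrite subrr. Qed.

Lemma add_gen_homogeneous J l : is_homogeneous_ideal J -> l \is 1.-homog ->
  is_homogeneous_ideal (add_gen J l).
Proof.
move=> [Jid Jhom] l1; have [J0 JD JM] := Jid; split; first split.
- exact: sub_add_gen.
- move=> F G [A JA] [B JB]; exists (A + B).
  by rewrite mulrDl opprD addrACA; apply: JD.
- by move=> H F [A JA]; exists (H * A); rewrite -mulrA -mulrBr; apply: JM.
move=> F d [A /(Jhom _ d)]; rewrite linearB /= mulrC.
case: d => [|d]; first by rewrite (pihomogMl_lt _ l1) // subr0; apply: sub_add_gen.
by rewrite -add1n (pihomogMl _ _ l1) mulrC; exists (pihomog mdeg d A).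
Qed.

Lemma sub_saturation J F G : J G -> saturation J F G.
Proof. by exists 0%N; rewrite mul1r. Qed.

(** The purpose of saturating: multiplication by [F] becomes injective modulo the ideal. *)
Lemma saturation_inj J F G : saturation J F (F * G) -> saturation J F G.
Proof. by case=> r; rewrite mulrA -exprSr; exists r.+1. Qed.

Lemma saturation_homogeneous J F d :
  is_homogeneous_ideal J -> F \is d.-homog ->
  is_homogeneous_ideal (saturation J F).
Proof.
move=> [Jid Jhom] Fd; have [J0 JD JM] := Jid; split; first split.
- exact: sub_saturation.
- move=> G H [a Ja] [b Jb]; exists (a + b)%N; rewrite mulrDr; apply: JD.
    by rewrite exprD [F ^+ a * _]mulrC -mulrA; apply: JM.
  by rewrite exprD -mulrA; apply: JM.
- by move=> H G [r Jr]; exists r; rewrite mulrCA; apply: JM.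
move=> G e [r /(Jhom _ (d * r + e)%N)]; rewrite pihomogMl ?dhomogMn //.
by exists r.
Qed.

Lemma add_gen_homog J l s e G : is_homogeneous_ideal J -> l \is 1.-homog ->
  contains_degree (add_gen J l) s -> (s <= e.+1)%N -> G \is e.+1.-homog ->
  exists2 H, H \is e.-homog & J (G - H * l).
Proof.
move=> Jh l1 Js le_se Ge.
(* By homogeneity of [J], any cofactor of [l] may be replaced by its component of degree [e]. *)
suff [H JH] : add_gen J l G.
  exists (pihomog mdeg e H); first exact: pihomogP.
  have [_ /(_ _ e.+1 JH)] := Jh; rewrite linearB /= pihomog_dE //.
  by rewrite mulrC -add1n (pihomogMl _ _ l1) mulrC.
have [[A0 AD AM] Ahom] := add_gen_homogeneous Jh l1.
(* Containing all forms of degree [s] passes to higher degrees, since a monomial of degree [d.+1] is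
   a variable times one of degree [d]. *)
suff Ad d : (s <= d)%N -> contains_degree (add_gen J l) d by apply: Ad Ge.
elim: d => [|d IHd]; first by rewrite leqn0 => /eqP s0; rewrite -s0.
rewrite leq_eqVlt => /predU1P[<- //|/IHd Ad] H; move: H; apply: dhomog_ind => //.
  by move=> c F AF; rewrite -mul_mpolyC; apply: AM.
move=> mu /mdegS_split[i [nu [-> nu_d]]]; rewrite mpolyXD; apply: AM.
by apply: Ad; rewrite dhomogX; apply/eqP.
Qed.

(** Divide by [l] modulo [J], [a] times; each quotient loses one degree, and [s + a <= t] keeps
    every division in the range of [add_gen_homog]. *)
Lemma add_gen_homogX J l s a t G : is_homogeneous_ideal J -> l \is 1.-homog ->
  contains_degree (add_gen J l) s -> (s + a <= t)%N -> G \is t.-homog ->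
  exists2 H, H \is (t - a).-homog & J (G - H * l ^+ a).
Proof.
move=> Jh l1 Js; have [[J0 JD JM] _] := Jh.
elim: a => [|a IHa] le_t Gt.
  by exists G; rewrite ?subn0 // mulr1 subrr.
have lt_t : (s + a < t)%N by rewrite -addnS.
have [H Hd JH] := IHa (ltnW lt_t) Gt.
have t_a : (t - a = (t - a.+1).+1)%N.
  by rewrite subnSK // (leq_trans _ lt_t) // ltnS leq_addl.
have le_s : (s <= t - a)%N by rewrite leq_subRL; [rewrite addnC ltnW | rewrite (leq_trans (leq_addl s a)) 1?ltnW].
rewrite t_a in Hd le_s.
have [H' H'd JH'] := add_gen_homog Jh l1 Js le_s Hd.
exists H' => //; rewrite exprS mulrA.
have -> : G - H' * l * l ^+ a = (G - H * l ^+ a) + (H - H' * l) * l ^+ a.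
  by rewrite mulrBl addrA subrK.
by apply: JD => //; rewrite mulrC; apply: JM.
Qed.

End HomogeneousIdeals.

(** Indexing by ordinals lets points and footprint monomials label the rows and columns of
    matrices. *)
Lemma finite_enum (T : Type) (A : set T) : finite_set A ->
  exists N (f : 'I_N -> T),
    [/\ A #= `I_N, injective f & forall x, A x <-> exists i, x = f i].
Proof.
move=> /finite_setP[N AN]; have /card_set_bijP[g [gA g_inj g_surj]] := AN.
have /boolp.choice[f fP] : forall i : 'I_N, exists x, A x /\ g x = i.
  by move=> i; have [x Ax gx] := g_surj i (ltn_ord i); exists x.
exists N, f; split=> // [i j fij|x].
  by apply: val_inj; rewrite /= -(fP i).2 -(fP j).2 fij.
split=> [Ax|[i ->]]; last exact: (fP i).1.
have lt_gN : (g x < N)%N by exact: gA.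
exists (Ordinal lt_gN); apply: g_inj; rewrite ?inE ?(fP _).2 //.
exact: (fP _).1.
Qed.

(** * Linear combinations of monomials *)

Section MonomialCombinations.
Variables (n : nat) (k : fieldType) (N : nat).

(** The coefficients form a row vector, so that linear maps become matrices acting on the right. *)
Definition mnm_comb (mu : 'I_N -> 'X_{1..n}) (c : 'rV[k]_N) : {mpoly k[n]} :=
  \sum_i c 0 i *: 'X_[mu i].

Variable mu : 'I_N -> 'X_{1..n}.

Lemma mnm_combD c d : mnm_comb mu (c + d) = mnm_comb mu c + mnm_comb mu d.
Proof.
rewrite /mnm_comb -big_split /=; apply: eq_bigr => i _.
by rewrite mxE scalerDl.
Qed.

Lemma mnm_combZ a c : mnm_comb mu (a *: c) = a *: mnm_comb mu c.
Proof.
by rewrite /mnm_comb scaler_sumr; apply: eq_bigr => i _; rewrite mxE scalerA.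
Qed.

Lemma mnm_combB c d : mnm_comb mu (c - d) = mnm_comb mu c - mnm_comb mu d.
Proof. by rewrite mnm_combD -scaleN1r mnm_combZ scaleN1r. Qed.

Lemma mnm_comb0 : mnm_comb mu 0 = 0.
Proof. by rewrite /mnm_comb big1 // => i _; rewrite mxE scale0r. Qed.

Lemma mnm_comb_delta i : mnm_comb mu (delta_mx 0 i) = 'X_[mu i].
Proof.
rewrite /mnm_comb (bigD1 i) //= mxE !eqxx scale1r big1 ?addr0 // => j j_i.
by rewrite mxE (negPf j_i) andbF scale0r.
Qed.

Lemma mnm_comb_homog c d :
  (forall i, mdeg (mu i) = d) -> mnm_comb mu c \is d.-homog.
Proof.
move=> mu_d; rewrite rpred_sum // => i _; rewrite rpredZ // dhomogX.
by apply/eqP; apply: mu_d.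
Qed.

Lemma mnm_comb_sum c (B : 'M[k]_N) :
  mnm_comb mu (c *m B) = \sum_i c 0 i *: mnm_comb mu (row i B).
Proof.
rewrite mulmx_sum_row (big_morph _ mnm_combD mnm_comb0).
by apply: eq_bigr => i _; rewrite mnm_combZ.
Qed.

End MonomialCombinations.

(** * The footprint as a basis of a graded piece of the quotient by [J] *)

Section FootprintBasis.
Variables (k : fieldType) (m : nat) (le : rel 'X_{1..m.+1}).
Hypothesis le_mo : monomial_order le.
Variables (J : set {mpoly k[m.+1]}) (e : nat).
Hypothesis J_homog : is_homogeneous_ideal J.

(** If the combination were nonzero, its leading monomial would be some [mu i], which the footprint
    excludes for elements of [J]. *)
Lemma footprint_indep N (mu : 'I_N -> 'X_{1..m.+1}) c : injective mu ->
  (forall i, proj_footprint le J e (mu i)) -> J (mnm_comb mu c) -> c = 0.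
Proof.
move=> mu_inj muD Jc; set F := mnm_comb mu c in Jc.
have Fe : F \is e.-homog by apply: mnm_comb_homog => i; case: (muD i).
have coefF i : F@_(mu i) = c 0 i.
  rewrite raddf_sum (bigD1 i) //= mcoeffZ mcoeffX eqxx mulr1 big1 ?addr0 //.
  by move=> j j_i; rewrite mcoeffZ mcoeffX (inj_eq mu_inj) (negPf j_i) mulr0.
apply/eqP; apply: contraT => c_neq0.
have F_neq0 : F != 0.
  apply: contraNneq c_neq0 => F0; apply/eqP/rowP => i.
  by rewrite -coefF F0 mcoeff0 mxE.
have [lmF _] := lm_supp_max le_mo F_neq0.
have [i lmi] : exists i, mu i = lm le F.
  apply: contrapT => nlm; move: lmF; rewrite mcoeff_msupp raddf_sum big1 ?eqxx //.
  move=> i _; rewrite /= mcoeffZ mcoeffX; case: eqP => [mui|]; last by rewrite mulr0.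
  by case: nlm; exists i.
by have [_ /(_ F Jc (homogE Fe) F_neq0)] := muD i.
Qed.

(** Division by leading monomials: a monomial outside the footprint is congruent modulo [J] to a
    combination of smaller monomials of the same degree. *)
Lemma footprint_span N (mu : 'I_N -> 'X_{1..m.+1}) F :
  (forall x, proj_footprint le J e x -> exists i, x = mu i) ->
  F \is e.-homog -> exists c, J (F - mnm_comb mu c).
Proof.
move=> muD; have [Jid _] := J_homog; have [J0 JD _] := Jid.
pose Sp F := exists c, J (F - mnm_comb mu c).
have Sp0 : Sp 0 by exists 0; rewrite mnm_comb0 subr0.
have SpD G H : Sp G -> Sp H -> Sp (G + H).
  move=> [c Jc] [d Jd]; exists (c + d).
  by rewrite mnm_combD opprD addrACA; apply: JD.
have SpZ a G : Sp G -> Sp (a *: G).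
  by move=> [c Jc]; exists (a *: c); rewrite mnm_combZ -scalerBr; apply: idealZ.
case: le_mo => leas letr letot _ _.
(* The induction measure is the number of monomials of degree at most [e] strictly below [nu]. *)
pose below (nu : 'X_{1..m.+1}) :=
  [set x : 'X_{1..m.+1 < e.+1} | le x nu && (bmnm x != nu)]%SET.
suff SpX : forall nu, mdeg nu = e -> Sp 'X_[nu] by exact: (dhomog_ind Sp0 SpD SpZ SpX).
move=> nu; have [h] := ubnP #|below nu|; elim: h nu => // h IHh nu le_h nu_e.
have [nuD|nuND] := pselect (proj_footprint le J e nu).
  have [i ->] := muD _ nuD; exists (delta_mx 0 i).
  by rewrite mnm_comb_delta subrr.
have [G [JG Ghom G_neq0 lmG]] :
    exists G, [/\ J G, G \is homog mdeg, G != 0 & nu = lm le G].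
  apply: contrapT => nG; apply: nuND; split=> // G JG Ghom G_neq0 lmG.
  by apply: nG; exists G.
have [] := lm_supp_max le_mo G_neq0; rewrite -lmG => nuG leG.
have Ge : G \is e.-homog.
  have /homogP[d Gd] := Ghom; have := dhomogP _ _ _ Gd _ nuG.
  by rewrite /= nu_e => ->.
have Gnu : G@_nu != 0 by rewrite -mcoeff_msupp.
(* The multiple of [G] cancels [nu], so that only monomials strictly below [nu] remain in [H]. *)
pose H := 'X_[nu] - (G@_nu)^-1 *: G.
have SpH : Sp H.
  rewrite [H]mpolyE big_seq; apply: big_ind => // x xH; apply: SpZ.
  have x_nu : x != nu.
    apply: contraTneq xH => ->; rewrite mcoeff_msupp mcoeffB mcoeffX eqxx.
    by rewrite mcoeffZ mulVf // subrr eqxx.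
  have xG : x \in msupp G.
    move: xH; rewrite !mcoeff_msupp; apply: contraNneq => xG.
    by rewrite mcoeffB mcoeffX [nu == x]eq_sym (negPf x_nu) mcoeffZ xG mulr0 subrr.
  have x_e : mdeg x = e by exact: (dhomogP _ _ _ Ge _ xG).
  apply: IHh => //; apply: leq_trans (_ : (#|below nu| <= h)%N) => //.
  apply: proper_card; apply/properP; split.
    apply/fintype.subsetP => y; rewrite !inE => /andP[y_x ny_x].
    rewrite (letr _ _ _ y_x (leG _ xG)) /=; apply: contraNneq ny_x => y_nu.
    by rewrite y_nu in y_x *; rewrite eq_sym; apply/eqP/leas; rewrite y_x leG.
  have lt_xe : (mdeg x < e.+1)%N by rewrite x_e.
  by exists (BMultinom lt_xe); rewrite !inE /= ?eqxx ?andbF // leG.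
have -> : 'X_[nu] = H + (G@_nu)^-1 *: G by rewrite subrK.
by apply: SpD => //; apply: SpZ; exists 0; rewrite mnm_comb0 subr0.
Qed.

End FootprintBasis.

(** * Eigenvectors in a graded piece of the quotient *)

Section Eigenvectors.
Variables (k : closedFieldType) (m : nat) (le : rel 'X_{1..m.+1}).
Hypothesis le_mo : monomial_order le.
Variables (J : set {mpoly k[m.+1]}) (l : {mpoly k[m.+1]}).
Hypotheses (J_homog : is_homogeneous_ideal J) (l1 : l \is 1.-homog).
Hypothesis l_inj : forall G, J (l * G) -> J G.

(* The hypotheses make [l : (S/J)_s -> (S/J)_(s+1)] bijective, so that the
   [l^-1 x_i] are commuting endomorphisms of [(S/J)_s]. *)
Lemma degree_eigenvector s :
  contains_degree (add_gen J l) s -> ~ contains_degree J s ->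
  exists C (p : 'rV[k]_m.+1), [/\ C \is s.-homog, ~ J C &
    forall i, J ('X_i * C - p 0 i *: (l * C))].
Proof.
move=> Js nJs; have [Jid _] := J_homog; have [J0 JD JM] := Jid.
have [N [mu [_ mu_inj muD]]] := finite_enum (finite_proj_footprint le J s).
have muDi i : proj_footprint le J s (mu i) by apply/muD; exists i.
have mu_s i : mdeg (mu i) = s by case: (muDi i).
have span := footprint_span le_mo J_homog (fun x => proj1 (muD x)).
have indep c : J (mnm_comb mu c) -> c = 0.
  exact: (footprint_indep le_mo mu_inj muDi).
(* [M i] is the matrix of [l^-1 x_i] in the footprint basis of degree [s]. *)
have /boolp.choice[M MP] : forall i : 'I_m.+1, exists B : 'M[k]_N,
    forall j, J ('X_i * 'X_[mu j] - l * mnm_comb mu (row j B)).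
  move=> i; suff /boolp.choice[f fP] : forall j, exists c,
      J ('X_i * 'X_[mu j] - l * mnm_comb mu c).
    exists (\matrix_j f j) => j; rewrite rowK; exact: fP.
  move=> j; have Xs : ('X_i * 'X_[mu j] : {mpoly k[m.+1]}) \is s.+1.-homog.
    rewrite -mpolyXD dhomogX; apply/eqP.
    by rewrite /= mdegD mdeg1 mu_s.
  have [H Hs JH] := add_gen_homog J_homog l1 Js (leqnSn s) Xs.
  have [c Jc] := span _ Hs; exists c.
  have -> : 'X_i * 'X_[mu j] - l * mnm_comb mu c =
      ('X_i * 'X_[mu j] - H * l) + l * (H - mnm_comb mu c) by ring.
  by apply: JD => //; apply: JM.
have act i c : J ('X_i * mnm_comb mu c - l * mnm_comb mu (c *m M i)).
  rewrite mnm_comb_sum /mnm_comb !mulr_sumr -sumrB; apply: ideal_sum => // j _.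
  by rewrite -!scalerAr -scalerBr; apply: idealZ.
have act2 i j c : J ('X_j * 'X_i * mnm_comb mu c -
    l * l * mnm_comb mu (c *m (M i *m M j))).
  have -> : 'X_j * 'X_i * mnm_comb mu c -
      l * l * mnm_comb mu (c *m (M i *m M j)) =
      'X_j * ('X_i * mnm_comb mu c - l * mnm_comb mu (c *m M i)) +
      l * ('X_j * mnm_comb mu (c *m M i) -
           l * mnm_comb mu (c *m M i *m M j)) by rewrite mulmxA; ring.
  by apply: JD; apply: JM.
have M_comm i j : comm_mx (M i) (M j).
  apply/row_matrixP => r; rewrite !rowE; apply/eqP; rewrite -subr_eq0.
  (* After multiplication by [l * l], both products of matrices represent multiplication by
     ['X_i * 'X_j]; then [l] is cancelled twice. *)
  apply/eqP/indep; do 2!apply: l_inj; rewrite mnm_combB.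
  have := idealB Jid (act2 j i (delta_mx 0 r)) (act2 i j (delta_mx 0 r)).
  by congr J; ring.
(* The footprint of degree [s] is nonempty: otherwise every form of degree [s] would lie in [J]. *)
have V_neq0 : 1%:M != 0 :> 'M[k]_N.
  apply/eqP => I0; apply: nJs => F /span [c].
  by rewrite -[c]mulmx1 I0 mulmx0 mnm_comb0 subr0.
have [|A B /mapP[i _ ->] /mapP[j _ ->]|v [v_neq0 _] vM] :=
    @common_eigenvector _ _ [seq M i | i <- enum 'I_m.+1] _ V_neq0.
- by move=> A _; rewrite stablemx_unit // unitmx1.
- exact: M_comm.
have /boolp.choice[p pP] : forall i, exists a, v *m M i = a *: v.
  by move=> i; apply: vM; apply/mapP; exists i; rewrite ?mem_enum.
exists (mnm_comb mu v), (\row_i p i); split.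
- exact: mnm_comb_homog.
- by move=> /indep v0; rewrite v0 eqxx in v_neq0.
by move=> i; have := act i v; rewrite pP mnm_combZ -scalerAr mxE.
Qed.

End Eigenvectors.

(** * Values of forms at points and on eigenvectors *)

Lemma meval_dhomogZ (k : fieldType) n (F : {mpoly k[n]}) d a (p : 'rV[k]_n) :
  F \is d.-homog -> F.@[(a *: p) 0] = a ^+ d * F.@[p 0].
Proof.
move=> /dhomogP Fd; rewrite !mevalE mulr_sumr !big_seq; apply: eq_bigr => mu muF.
rewrite mulrCA; congr (_ * _); rewrite -(Fd _ muF) /= mdegE -prodrXr -big_split.
by apply: eq_bigr => i _; rewrite mxE exprMn.
Qed.

(** The eigenvalues [p] are the coordinates of a point: replacing the variables of a monomial one by
    one turns each into a factor [p 0 i] and a factor [l]. *)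
Lemma eigenvector_meval (k : fieldType) n (J : set {mpoly k[n]}) l C
    (p : 'rV[k]_n) G d : is_ideal J ->
  (forall i, J ('X_i * C - p 0 i *: (l * C))) -> G \is d.-homog ->
  J (G * C - G.@[p 0] *: (l ^+ d * C)).
Proof.
move=> Jid JXC; have [J0 JD JM] := Jid.
pose P d G := J (G * C - G.@[p 0] *: (l ^+ d * C)).
suff PX : forall d mu, mdeg mu = d -> P d 'X_[mu].
  apply: (@dhomog_ind _ _ (P d) d _ _ _ (PX d)) => [|A B JA JB|c A JA]; rewrite /P.
  - by rewrite mul0r meval0 scale0r subrr.
  - by rewrite mulrDl mevalD scalerDl opprD addrACA; apply: JD.
  - by rewrite mevalZ -scalerAl -scalerA -scalerBr; apply: idealZ.
elim=> [|e IHe] mu.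
  move/eqP; rewrite mdeg_eq0 => /eqP->.
  by rewrite /P mpolyX0 meval1 !mul1r scale1r subrr.
move=> /mdegS_split[i [nu [-> nu_e]]]; rewrite /P mpolyXD mevalM mevalXU.
have -> : 'X_i * 'X_[nu] * C - (p 0 i * 'X_[nu].@[p 0]) *: (l ^+ e.+1 * C) =
    'X_i * ('X_[nu] * C - 'X_[nu].@[p 0] *: (l ^+ e * C)) +
    'X_[nu].@[p 0]%:MP * l ^+ e * ('X_i * C - p 0 i *: (l * C)).
  by rewrite -!mul_mpolyC mpolyCM exprS; ring.
by apply: JD; apply: JM => //; apply: IHe.
Qed.

(** * The Nullstellensatz through saturation and eigenvectors *)

Section Nullstellensatz.
Variables (k : closedFieldType) (m : nat) (le : rel 'X_{1..m.+1}).
Hypothesis le_mo : monomial_order le.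
Implicit Types (J : set {mpoly k[m.+1]}) (F G l : {mpoly k[m.+1]}).
Implicit Types (P : proj_space k m) (p : 'rV[k]_m.+1).

Lemma proj_space_repr P : exists2 p, p != 0 & val P = <[p]>%VS.
Proof.
have P_neq0 : val P != 0%VS by rewrite -dimv_eq0 (eqP (valP P)).
exists (vpick (val P)); first by rewrite vpick0.
apply/esym/eqP; rewrite eqEdim -memvE memv_pick /= (eqP (valP P)).
by rewrite dim_vline vpick0 P_neq0.
Qed.

Lemma vanishes_at_line F d P p : p != 0 -> val P = <[p]>%VS -> F \is d.-homog ->
  vanishes_at F P <-> F.@[p 0] = 0.
Proof.
move=> p_neq0 Pp Fd; rewrite /vanishes_at Pp; split=> [FP|Fp v].
  by apply: FP => //; rewrite memv_line.
by move=> /vlineP[a ->] _; rewrite (meval_dhomogZ _ _ Fd) Fp mulr0.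
Qed.

Lemma vanishing_power_contains J l s F d : is_homogeneous_ideal J ->
  l \is 1.-homog -> contains_degree (add_gen J l) s -> F \is d.-homog ->
  (forall P, proj_variety J P -> vanishes_at F P) ->
  exists a t, forall e G, (t <= e)%N -> G \is e.-homog -> J (F ^+ a * G).
Proof.
move=> Jh l1 Js Fd FV; have [[J0 JD JM] _] := Jh.
have Flhom : F * l \is (d + 1).-homog by exact: dhomogM.
have J'h := saturation_homogeneous Jh Flhom.
set J' := saturation J (F * l) in J'h.
have [J'id _] := J'h; have [_ J'D J'M] := J'id.
have [J's|nJ's] := pselect (contains_degree J' s).
  have [r Jr] : J' (l ^+ s) by apply: J's; have := dhomogMn s l1; rewrite mul1n.
  (* Here [(F * l) ^+ r * l ^+ s] lies in [J], hence so does [F ^+ (r + s) * l ^+ (r + s)]; from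
     degree [s + (r + s)] on, every form is a multiple of [l ^+ (r + s)] modulo [J]. *)
  exists (r + s)%N, (s + (r + s))%N => e G le_te Ge.
  have [H _ JH] := add_gen_homogX Jh l1 Js le_te Ge.
  have -> : F ^+ (r + s) * G = F ^+ (r + s) * (G - H * l ^+ (r + s)) +
      H * F ^+ s * ((F * l) ^+ r * l ^+ s) by rewrite exprMn !exprD; ring.
  by apply: JD; apply: JM.
exfalso; have J'l G : J' (l * G) -> J' G.
  by move=> /(J'M F); rewrite mulrA; apply: saturation_inj.
have J'lX G e : J' (l ^+ e * G) -> J' G.
  by elim: e => [|e IHe]; rewrite ?mul1r // exprS -mulrA => /J'l.
have J's : contains_degree (add_gen J' l) s.
  by move=> G /Js[H JH]; exists H; apply: sub_saturation.
have [C [p [_ nJC JXC]]] := degree_eigenvector le_mo J'h l1 J'l J's nJ's.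
have act G e := @eigenvector_meval _ _ _ _ _ _ G e J'id JXC.
(* Otherwise [l ^+ e * C] would lie in [J'], and so would [C], since [l] can be cancelled. *)
have zero G e : G \is e.-homog -> J' (G * C) -> G.@[p 0] = 0.
  move=> Ge JGC; apply/eqP; apply: contra_notT nJC => Gp.
  apply: (J'lX _ e); rewrite -[_ * C]scale1r -(mulVf Gp) -scalerA.
  apply: idealZ => //; rewrite -[_ *: _](subKr (G * C)).
  by apply: idealB => //; apply: act.
have p_neq0 : p != 0.
  (* If [p] were 0, then [l] would vanish at [p], which puts [l * C] in [J']; writing 0 as [0 *: 0]
     gives that value by homogeneity. *)
  apply: contra_notN nJC => /eqP p0; apply: J'l.
  have := act l _ l1; rewrite p0 -(scale0r (0 : 'rV[k]_m.+1)).
  by rewrite (meval_dhomogZ _ _ l1) mul0r scale0r subr0.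
have P1 : \dim <[p]>%VS == 1%N by rewrite dim_vline p_neq0.
pose P : proj_space k m := exist _ <[p]>%VS P1.
have Pp : val P = <[p]>%VS by [].
have PV : proj_variety J P.
  move=> G JG /homogP[e Ge]; apply/(vanishes_at_line p_neq0 Pp Ge).
  by apply: (zero G e) => //; apply: idealMr => //; apply: sub_saturation.
have /(vanishes_at_line p_neq0 Pp Fd) Fp := FV P PV.
(* Since [F] vanishes at [p], [F * C] lies in [J']; the saturation by [F * l] then forces [C] into
   [J']. *)
apply: nJC; apply: (@saturation_inj _ _ _ (F * l)).
have := act F _ Fd; rewrite Fp scale0r subr0 => /(J'M l).
by rewrite mulrA [l * F]mulrC.
Qed.

Lemma foldl_add_gen_homogeneous J ls : is_homogeneous_ideal J ->
  {in ls, forall l, l \is 1.-homog} ->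
  is_homogeneous_ideal (foldl (@add_gen _ _) J ls).
Proof.
elim: ls J => //= l ls IHls J Jh ls1; apply: IHls => [|l' l'ls].
  by apply: add_gen_homogeneous => //; apply: ls1; rewrite mem_head.
by apply: ls1; rewrite inE l'ls orbT.
Qed.

Lemma mem_foldl_add_gen J ls l : is_homogeneous_ideal J ->
  {in ls, forall l, l \is 1.-homog} -> l \in ls -> foldl (@add_gen _ _) J ls l.
Proof.
elim: ls J => //= l' ls IHls J Jh ls1.
have l'1 : l' \is 1.-homog by apply: ls1; rewrite mem_head.
rewrite inE => /predU1P[->|lls]; last first.
  apply: IHls lls => [|l'' l''ls]; first exact: add_gen_homogeneous.
  by apply: ls1; rewrite inE l''ls orbT.
have [Jid _] := Jh; have : add_gen J l' l'.
  by rewrite -{2}[l']mul1r; apply: add_genM.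
elim: ls (add_gen J l') {IHls ls1} => //= l'' ls IHls I Il'.
by apply: IHls; apply: sub_add_gen.
Qed.

(** The case [F = 1] of [vanishing_power_contains] removes one generator at a time; the larger
    ideals still have no zeros. *)
Lemma foldl_add_gen_contains J ls s : is_homogeneous_ideal J ->
  {in ls, forall l, l \is 1.-homog} -> (forall P, ~ proj_variety J P) ->
  contains_degree (foldl (@add_gen _ _) J ls) s ->
  exists s', contains_degree J s'.
Proof.
elim: ls J => [|l ls IHls] J Jh ls1 V0 /= Js; first by exists s.
have l1 : l \is 1.-homog by apply: ls1; rewrite mem_head.
have [|l' l'ls|P PV|s' Js'] := IHls _ _ _ _ Js.
- exact: add_gen_homogeneous.
- by apply: ls1; rewrite inE l'ls orbT.
- by case: (V0 P) => G JG; apply: PV; apply: sub_add_gen.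
have [P /V0 //|a [t Jt]] :=
  vanishing_power_contains Jh l1 Js' (dhomog1 k mdeg).
by exists t => G Gt; have := Jt t G (leqnn t) Gt; rewrite expr1n mul1r.
Qed.

Lemma projective_weak_nullstellensatz J : is_homogeneous_ideal J ->
  (forall P, ~ proj_variety J P) -> exists s, contains_degree J s.
Proof.
move=> Jh V0; pose ls : seq {mpoly k[m.+1]} := [seq 'X_i | i <- enum 'I_m.+1].
have ls1 : {in ls, forall l, l \is 1.-homog}.
  by move=> _ /mapP[i _ ->]; rewrite dhomogX /= mdeg1.
apply: (@foldl_add_gen_contains J ls 1) => //.
have [[I0 ID IM] _] := foldl_add_gen_homogeneous Jh ls1.
apply: dhomog_ind => // [c F IF|mu mu1].
  by rewrite -mul_mpolyC; apply: IM.
have /mdeg1P[i /eqP->] : mdeg mu == 1%N by rewrite mu1.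
by apply: mem_foldl_add_gen => //; apply/mapP; exists i; rewrite ?mem_enum.
Qed.

End Nullstellensatz.

(** * Forms avoiding or separating finitely many points *)

Section LinearForms.
Variables (k : closedFieldType) (m : nat).
Implicit Types (p q : 'rV[k]_m.+1).

(** The form with coefficients [t ^+ i] takes at [p j] the value at [t] of a nonzero polynomial
    [q j]; choose [t] outside the roots of the product of the [q j]. *)
Lemma avoiding_form N (p : 'I_N -> 'rV[k]_m.+1) : (forall j, p j != 0) ->
  exists2 l : {mpoly k[m.+1]}, l \is 1.-homog & forall j, l.@[p j 0] != 0.
Proof.
move=> p_neq0; pose q j := \poly_(i < m.+1) p j 0 (inord i).
have q_neq0 j : q j != 0.
  apply: contraNneq (p_neq0 j) => qj0; apply/eqP/rowP => i.
  by have := coef_poly m.+1 (fun i => p j 0 (inord i)) i;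
     rewrite -/(q j) qj0 coef0 ltn_ord inord_val mxE.
have /closed_nonrootP[t] : \prod_j q j != 0 by apply/prodf_neq0.
rewrite /root horner_prod => /prodf_neq0 qt.
exists (\sum_(i < m.+1) t ^+ i *: 'X_i).
  by rewrite rpred_sum // => i _; rewrite rpredZ // dhomogX /= mdeg1.
move=> j; have := qt j isT; rewrite horner_poly raddf_sum; congr (_ != 0).
by apply: eq_bigr => i _; rewrite /= mevalZ mevalXU inord_val mulrC.
Qed.

(** Some 2 by 2 minor of the rows [q] and [p] is nonzero; expanding it along [p] gives the form. *)
Lemma separating_form p q : q != 0 -> p \notin <[q]>%VS ->
  exists l : {mpoly k[m.+1]}, [/\ l \is 1.-homog, l.@[p 0] != 0 & l.@[q 0] = 0].
Proof.
move=> /rV0Pn[b qb] pNq.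
have [a ab] : exists a, q 0 b * p 0 a - q 0 a * p 0 b != 0.
  apply: contrapT => n_ab; case/vlineP: pNq; exists (p 0 b / q 0 b).
  apply/rowP => a; rewrite mxE; have [eq_ab|ab] := eqVneq (q 0 b * p 0 a - q 0 a * p 0 b) 0.
    move/eqP: eq_ab; rewrite subr_eq0 => /eqP eq_ab.
    by apply: (mulfI qb); rewrite eq_ab; field.
  by case: n_ab; exists a.
exists (q 0 b *: 'X_a - q 0 a *: 'X_b); split.
- by rewrite rpredB // rpredZ // dhomogX /= mdeg1.
- by rewrite mevalB !mevalZ !mevalXU.
by rewrite mevalB !mevalZ !mevalXU; ring.
Qed.

Lemma separating_polynomial N (p : 'I_N -> 'rV[k]_m.+1) i e :
  (forall j, p j != 0) -> (forall j, j != i -> p i \notin <[p j]>%VS) ->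
  (N <= e)%N ->
  exists2 f : {mpoly k[m.+1]}, f \is e.-homog &
    forall j, f.@[p j 0] = (j == i)%:R.
Proof.
move=> p_neq0 pN le_Ne.
have /boolp.choice[h hP] : forall j, exists l : {mpoly k[m.+1]},
    [/\ l \is 1.-homog, l.@[p i 0] != 0 & j != i -> l.@[p j 0] = 0].
  move=> j; have [_|/pN/(separating_form (p_neq0 j))[l [l1 li lj]]] := eqVneq j i.
    by have [l l1 lp] := avoiding_form p_neq0; exists l; split=> //; apply: lp.
  by exists l.
have prod_homog n (g : 'I_n -> {mpoly k[m.+1]}) :
    (forall j, g j \is 1.-homog) -> \prod_j g j \is n.-homog.
  elim: n g => [|n IHn] g g1; first by rewrite big_ord0 dhomog1.
  rewrite big_ord_recl; apply: (dhomogM (d := 1) (e := n)) => //.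
    exact: IHn.
(* The factor [h j] kills [p j] for [j != i]; the power of [h i], which is nonzero at [p i], raises
   the degree from [N] to [e]. *)
pose g := \prod_j h j * h i ^+ (e - N).
have ge : g \is e.-homog.
  rewrite -(subnKC le_Ne) dhomogM ?prod_homog // => [j|].
    by case: (hP j).
  by have [hi1 _ _] := hP i; have := dhomogMn (e - N) hi1; rewrite mul1n.
have gi : g.@[p i 0] != 0.
  rewrite mevalM rmorph_prod rmorphXn /= mulf_neq0 // ?expf_neq0 //.
    by apply/prodf_neq0 => j _; case: (hP j).
  by case: (hP i).
exists (g.@[p i 0]^-1 *: g); first by rewrite rpredZ.
move=> j; rewrite mevalZ; have [->|j_i] := eqVneq j i; first by rewrite mulVf.
rewrite [X in _ * X]mevalM rmorph_prod (bigD1 j) //=.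
by have [_ _ hj] := hP j; rewrite hj // !mul0r mulr0.
Qed.

End LinearForms.

Lemma finite_projective_nullstellensatz (k : closedFieldType) m
    (le : rel 'X_{1..m.+1}) (J : set {mpoly k[m.+1]}) F d :
  monomial_order le -> is_homogeneous_ideal J -> finite_set (proj_variety J) ->
  (0 < d)%N -> F \is d.-homog ->
  (forall P, proj_variety J P -> vanishes_at F P) -> radical J F.
Proof.
move=> le_mo Jh /finite_enum[N [P [_ _ PV]]] d_gt0 Fd FV.
have /boolp.choice[p pP] : forall i, exists p, p != 0 /\ val (P i) = <[p]>%VS.
  by move=> i; have [p p_neq0 Pp] := proj_space_repr (P i); exists p.
have [l l1 lp] := avoiding_form (fun i => (pP i).1).
have [Jid _] := Jh.
have [|s Js] := projective_weak_nullstellensatz le_mo (add_gen_homogeneous Jh l1).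
  move=> Q QV; have [|i Qi] := (PV Q).1.
    by move=> G JG; apply: QV; apply: sub_add_gen.
  have [p_neq0 Pp] := pP i; have := lp i; rewrite Qi in QV.
  rewrite (vanishes_at_line p_neq0 Pp l1).1 ?eqxx //.
  apply: QV; last exact: homogE l1.
  by rewrite -{2}[l]mul1r; apply: add_genM.
have [a [t Jt]] := vanishing_power_contains le_mo Jh l1 Js Fd FV.
(* As [d > 0], the form [F ^+ t] has degree at least [t] and can serve as the cofactor of
   [F ^+ a]. *)
exists (a + t)%N; rewrite exprD; apply: (Jt (d * t)%N); last exact: dhomogMn.
by rewrite leq_pmull.
Qed.

(** * Comparison of the points with the footprint *)

Theorem theorem3p4 (k : closedFieldType) (m : nat) (m_gt0 : (0 < m)%N)
    (le : rel 'X_{1..m.+1}) (le_mo : monomial_order le)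
    (le_vars : forall i j : 'I_m.+1, (i < j)%N -> ~~ le U_(i)%MM U_(j)%MM)
    (J : set {mpoly k[m.+1]}) (J_homog : is_homogeneous_ideal J)
    (V_fin : finite_set (proj_variety J)) :
  (exists e0 : nat, forall e : nat, (e0 <= e)%N ->
     proj_variety J #<= proj_footprint le J e) /\
  (radical J = J ->
   exists e0 : nat, forall e : nat, (e0 <= e)%N ->
     proj_variety J #= proj_footprint le J e).
Proof.
have [N [P [VN P_inj PV]]] := finite_enum V_fin.
have /boolp.choice[p pP] : forall i, exists p, p != 0 /\ val (P i) = <[p]>%VS.
  by move=> i; have [p p_neq0 Pp] := proj_space_repr (P i); exists p.
have p_neq0 i := (pP i).1; have Pp i := (pP i).2.
have p_indep i j : j != i -> p i \notin <[p j]>%VS.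
  apply: contraNN => p_ij; apply/eqP/P_inj/val_inj; rewrite !Pp.
  by apply/esym/eqP; rewrite eqEdim -memvE p_ij !dim_vline !p_neq0.
(* Evaluation matrix of monomials at the points: a right inverse of the evaluation shows [N <= n],
   and its injectivity shows [n <= N]. *)
pose B n (mu : 'I_n -> 'X_{1..m.+1}) : 'M[k]_(n, N) :=
  \matrix_(i, j) 'X_[mu i].@[p j 0].
have BE n (mu : 'I_n -> 'X_{1..m.+1}) c j :
    (mnm_comb mu c).@[p j 0] = (c *m B n mu) 0 j.
  rewrite /mnm_comb raddf_sum mxE; apply: eq_bigr => i _.
  by rewrite /= mevalZ mxE.
have le_card e n (mu : 'I_n -> 'X_{1..m.+1}) : (N <= e)%N ->
    (forall x, proj_footprint le J e x <-> exists i, x = mu i) -> (N <= n)%N.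
  move=> le_Ne muD.
  have mu_e i : mdeg (mu i) = e.
    by have [] : proj_footprint le J e (mu i) by apply/muD; exists i.
  have /boolp.choice[c cP] : forall i : 'I_N, exists c : 'rV_n,
      forall j, (c *m B n mu) 0 j = (j == i)%:R.
    move=> i; have [f fe fP] := separating_polynomial p_neq0 (p_indep i) le_Ne.
    have [c Jc] := footprint_span le_mo J_homog (fun x => (muD x).1) fe.
    exists c => j; rewrite -BE -fP; apply/esym/eqP; rewrite -subr_eq0 -mevalB.
    have fce : f - mnm_comb mu c \is e.-homog.
      by rewrite rpredB // mnm_comb_homog.
    apply/eqP/(vanishes_at_line (p_neq0 j) (Pp j) fce).
    have Vj : proj_variety J (P j) by apply/PV; exists j.
    by apply: Vj => //; apply: homogE fce.
  apply: (@mulmx1_min _ _ _ (\matrix_i c i) (B n mu)).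
  apply/row_matrixP => i; rewrite row_mul rowK; apply/rowP => j.
  by rewrite cP !mxE eq_sym.
split=> [|Jrad].
  exists N => e le_Ne.
  have [n [mu [Dn _ muD]]] := finite_enum (finite_proj_footprint le J e).
  by rewrite (card_le_eql VN) (card_le_eqr Dn) card_le_II (le_card e n mu).
(* The bound [N.+1] makes [e] positive even if there are no points, as the Nullstellensatz for
   finite sets requires. *)
exists N.+1 => e lt_Ne.
have [n [mu [Dn mu_inj muD]]] := finite_enum (finite_proj_footprint le J e).
have mu_D i : proj_footprint le J e (mu i) by apply/muD; exists i.
suff le_nN : (n <= N)%N.
  rewrite (card_eql VN) (card_eqr Dn); apply/card_eq_II/eqP.
  by rewrite eqn_leq le_nN (le_card e n mu) // ltnW.
(* A combination vanishing at all the points lies in the radical of [J], which is [J], so its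
   coefficients are 0. *)
have /eqP <- : row_free (B n mu); last exact: rank_leq_col.
apply: inj_row_free => c cB0.
apply: (footprint_indep le_mo mu_inj mu_D); rewrite -Jrad.
have Fe : mnm_comb mu c \is e.-homog.
  by apply: mnm_comb_homog => i; case: (mu_D i).
apply: (finite_projective_nullstellensatz le_mo J_homog V_fin _ Fe).
  exact: leq_ltn_trans lt_Ne.
move=> Q /PV[j ->]; apply/(vanishes_at_line (p_neq0 j) (Pp j) Fe).
by rewrite BE cB0 mxE.
Qed.
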